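(* Let $\gamma_A$ be the position vectors of the world-lines $\gamma_A(\tau^A)$, $A=1,2,3,4$, of the four emitters of a positioning system in Minkowski space-time with respect to an inertial coordinate system $\{x^\alpha\}$, and let $\{\tau^A\}$ be their emission coordinates. In all the emission coordinate region $\mathcal{C}=\mathcal{C}^F\cup\mathcal{C}^B$, the coordinate transformation $x=\kappa(\tau^A)$ from emission to inertial coordinates is given by $$x=\gamma_4+y_*-\frac{y_*^2\,\chi}{(y_*\cdot\chi)+\hat\epsilon\sqrt{(y_*\cdot\chi)^2-y_*^2\,\chi^2}},$$ where $\chi$ is the configuration vector, $y_*=\frac{1}{\xi\cdot\chi}\,i(\xi)H$ with $\xi$ a chosen transversal vector, i.e. $\xi\cdot\chi\neq0$, and $\hat\epsilon=\mathrm{sgn}\,{*}(m_1\wedge m_2\wedge m_3\wedge m_4)$, $m_A=x-\gamma_A$, is the orientation of the positioning system with respect to the event $x$ that receives the data $\{\tau^A\}$.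
   Context: Minkowski space-time is identified, via a choice of origin of an inertial chart, with a 4-dimensional real oriented and time-oriented vector space with Lorentzian inner product $\cdot$ of signature $2\epsilon$, $\epsilon=\pm1$ fixed ($\epsilon=+1$: $(-,+,+,+)$; $\epsilon=-1$: $(+,-,-,-)$). Write $v^2=v\cdot v$. A time-like or nonzero null vector $v$ is future-pointing iff $\epsilon\,u\cdot v<0$ for a future-pointing time-like $u$. Let $\eta$ be the metric volume form. Conventions: ${*}(v_1\wedge v_2\wedge v_3\wedge v_4)=\eta(v_1,v_2,v_3,v_4)$; ${*}(v_1\wedge v_2\wedge v_3)$ is the vector $w$ with $w\cdot u=\eta(u,v_1,v_2,v_3)$ for all $u$; ${*}(v_1\wedge v_2)$ is the bivector $B$ with $B(u,w)=\eta(u,w,v_1,v_2)$; $i(\xi)B$ is the vector with $(i(\xi)B)\cdot w=B(\xi,w)$ for all $w$. Positioning system: four distinct smooth future-directed time-like curves $\gamma_A(\tau^A)$ parametrized by proper time. The emission region is the set of $x$ for which there are values $\tau^A$ such that each $m_A=x-\gamma_A(\tau^A)$ satisfies $m_A^2=0$ and $\epsilon\,u\cdot m_A<0$ for a future-pointing time-like $u$ (i.e. $m_A$ is future-pointing null); these $\tau^A$ are the emission coordinates of $x$, and $\Theta$ denotes the map $x\mapsto(\tau^A)$. The emission coordinate region $\mathcal{C}$ is the set of such $x$ with $m_1\wedge m_2\wedge m_3\wedge m_4\neq0$. For the configuration $\gamma_A=\gamma_A(\tau^A)$ of the emitters for $x$: $e_a=\gamma_a-\gamma_4$ ($a=1,2,3$),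 $\Omega_a=\frac12 e_a^2$, $\chi={*}(e_1\wedge e_2\wedge e_3)$ (configuration vector), $E^a={*}(e_{a+1}\wedge e_{a+2})$ (indices mod 3), $H=\sum_a\Omega_aE^a$. On $\mathcal{C}$, $\chi\neq0$. The region $\mathcal{C}$ is the union of two coordinate domains of emission coordinates. The front domain $\mathcal{C}^F$ is the one containing all events of $\mathcal{C}$ with $\epsilon\chi^2<0$ (space-like configurations), all those with $\chi^2=0$ (null configurations), and a part $\mathcal{C}^F_t$ of the set $\mathcal{C}_t$ of those with $\epsilon\chi^2>0$ (time-like configurations). The back domain is $\mathcal{C}^B=\mathcal{C}_t-\mathcal{C}^F_t$; it contains only events with time-like configurations, and $\Theta(\mathcal{C}^F_t)=\Theta(\mathcal{C}^B)$.
   Formalization: The formula is asserted for each transversal ξ for which its denominator is nonzero; for exceptional transversal ξ (e.g. the other null vector on the line x − γ₄ + ℝχ) it is 0/0. It is also proved that at every event of C some transversal ξ gives a nonzero denominator. *)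

(* Defs.v *)
From HB Require Import structures.
From mathcomp Require Import all_boot all_order all_algebra.
From mathcomp Require Import all_classical all_reals all_analysis.
Set Implicit Arguments.
Unset Strict Implicit.
Unset Printing Implicit Defensive.
Import Order.TTheory GRing.Theory Num.Theory.
Import numFieldNormedType.Exports.
Local Open Scope classical_set_scope.
Local Open Scope ring_scope.

Notation vec R := 'rV[R]_4.

Section Minkowski.
Variable R : realType.

Definition msign (i : 'I_4) : R := if i == ord0 then -1 else 1.

Definition lorentz (eps : R) (u v : vec R) : R :=
  eps * \sum_i msign i * (u 0 i * v 0 i).

(* Minkowski space in an inertial chart x^0, ..., x^3. The chart need not be
   adapted to the orientation or to the time orientation: these are given by
   the value [ori] of the metric volume form on the coordinate basis and by a
   future-pointing time-like vector [fut]. *)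
Record minkowski_space := MinkowskiSpace {
  eps : R;
  ori : R;
  fut : vec R;
  epsP : eps = 1 \/ eps = -1;
  oriP : ori = 1 \/ ori = -1;
  futP : eps * lorentz eps fut fut < 0 }.

Variable M : minkowski_space.

Definition dot (u v : vec R) : R := lorentz (eps M) u v.

Definition timelike (v : vec R) : Prop := eps M * dot v v < 0.

(* Meant for [v] time-like or null; it excludes [v = 0]. *)
Definition future (v : vec R) : Prop := eps M * dot (fut M) v < 0.

Definition vol (v0 v1 v2 v3 : vec R) : R :=
  ori M * \det (\matrix_(i < 4) nth 0 [:: v0; v1; v2; v3] i).

(* For a linear form [f], the vector [w] with [dot w u = f u] for all [u];
   see [dot_sharp]. *)
Definition sharp (f : vec R -> R) : vec R :=
  \row_i (eps M * msign i * f (delta_mx 0 i)).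

Definition star3 (v1 v2 v3 : vec R) : vec R :=
  sharp (fun u => vol u v1 v2 v3).

(* Bivectors are represented by the associated alternating bilinear forms. *)
Definition bivec := vec R -> vec R -> R.

Definition star2 (v1 v2 : vec R) : bivec := fun u w => vol u w v1 v2.

Definition contract (xi : vec R) (B : bivec) : vec R := sharp (B xi).

Lemma dot_sharp (f : {scalar vec R}) (u : vec R) : dot (sharp f) u = f u.
Proof.
rewrite {2}[u]row_sum_delta linear_sum /dot /lorentz mulr_sumr.
apply: eq_bigr => i _; rewrite !mxE linearZ /=.
have e2 : eps M * eps M = 1 by case: (epsP M) => ->; rewrite ?mulrNN mulr1.
have d2 : msign i * msign i = 1 by rewrite /msign; case: ifP; rewrite ?mulrNN mulr1.
rewrite -!mulrA [f _ * _]mulrC.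
rewrite [msign i * (eps M * _)]mulrCA !mulrA e2 mul1r.
by rewrite d2 mul1r.
Qed.

Lemma vol_linear1 (v1 v2 v3 : vec R) : scalar (fun u => vol u v1 v2 v3).
Proof.
move=> a u v; rewrite /vol.
rewrite (@determinant_multilinear _ _ _
  (\matrix_(i < 4) nth 0 [:: u; v1; v2; v3] i)
  (\matrix_(i < 4) nth 0 [:: v; v1; v2; v3] i) ord0 a 1).
- by rewrite mul1r mulrDr mulrCA.
- by rewrite !rowK scale1r.
- by apply/matrixP => i j; rewrite !mxE.
- by apply/matrixP => i j; rewrite !mxE.
Qed.

Lemma vol_linear2 (v0 v2 v3 : vec R) : scalar (fun u => vol v0 u v2 v3).
Proof.
move=> a u v; rewrite /vol.
rewrite (@determinant_multilinear _ _ _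
  (\matrix_(i < 4) nth 0 [:: v0; u; v2; v3] i)
  (\matrix_(i < 4) nth 0 [:: v0; v; v2; v3] i) (lift ord0 ord0) a 1).
- by rewrite mul1r mulrDr mulrCA.
- by rewrite !rowK scale1r.
- by apply/matrixP => -[[|[|[|k]]] Hi] j //; rewrite !mxE.
- by apply/matrixP => -[[|[|[|k]]] Hi] j //; rewrite !mxE.
Qed.

Lemma dot_star3 (v1 v2 v3 u : vec R) : dot (star3 v1 v2 v3) u = vol u v1 v2 v3.
Proof.
pose f := GRing.isLinear.Build _ _ _ _ _ (vol_linear1 v1 v2 v3).
pose F : {scalar vec R} := HB.pack (fun u => vol u v1 v2 v3) f.
exact: (dot_sharp F u).
Qed.

Lemma dot_contract_star2 (xi v1 v2 w : vec R) :
  dot (contract xi (star2 v1 v2)) w = vol xi w v1 v2.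
Proof.
pose f := GRing.isLinear.Build _ _ _ _ _ (vol_linear2 xi v1 v2).
pose F : {scalar vec R} := HB.pack (fun u => vol xi u v1 v2) f.
exact: (dot_sharp F w).
Qed.

End Minkowski.

Section Positioning.
Variables (R : realType) (M : minkowski_space R).

(* The emitters 1, 2, 3, 4 are indexed by 'I_4 = {0, 1, 2, 3}. Emitter [A] has
   world-line [wl A], parametrized by proper time on the open interval [dom A];
   its values outside [dom A] are irrelevant. *)
Record positioning_system := PositioningSystem {
  dom : 'I_4 -> set R;
  wl : 'I_4 -> R -> vec R;
  dom_open : forall A, open (dom A);
  dom_itv : forall A, is_interval (dom A);
  wl_smooth : forall A (n : nat) t, dom A t -> derivable (derive1n n (wl A)) t 1;
  wl_timelike : forall A t, dom A t -> timelike M (derive1 (wl A) t);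
  wl_future : forall A t, dom A t -> future M (derive1 (wl A) t);
  wl_proper : forall A t, dom A t ->
    dot M (derive1 (wl A) t) (derive1 (wl A) t) = - eps M;
  wl_distinct : forall A B, A != B -> wl A @` dom A <> wl B @` dom B }.

Variable P : positioning_system.

Definition mvec (x : vec R) (tau : 'I_4 -> R) (A : 'I_4) : vec R :=
  x - wl P A (tau A).

Definition emission_coordinates (x : vec R) (tau : 'I_4 -> R) : Prop :=
  forall A, [/\ dom P A (tau A), dot M (mvec x tau A) (mvec x tau A) = 0
    & future M (mvec x tau A)].

Definition star4 (m : 'I_4 -> vec R) : R :=
  vol M (m (inord 0)) (m (inord 1)) (m (inord 2)) (m (inord 3)).

(* The Hodge dual is injective on 4-vectors, so m_1 /\ m_2 /\ m_3 /\ m_4 <> 0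
   amounts to [star4 m != 0]. *)
Definition emission_coordinate_region : set (vec R) :=
  [set x | exists2 tau, emission_coordinates x tau & star4 (mvec x tau) != 0].

Definition orientation (x : vec R) (tau : 'I_4 -> R) : R :=
  Num.sg (star4 (mvec x tau)).

Section Configuration.
Variable tau : 'I_4 -> R.

Definition gamma4 : vec R := wl P ord_max (tau ord_max).

Definition evec (a : 'I_3) : vec R :=
  let A : 'I_4 := widen_ord (leqnSn 3) a in wl P A (tau A) - gamma4.

Definition Omega (a : 'I_3) : R := dot M (evec a) (evec a) / 2.

Definition chi : vec R :=
  star3 M (evec (inord 0)) (evec (inord 1)) (evec (inord 2)).

(* [ordS] is the successor modulo 3. *)
Definition Ebiv (a : 'I_3) : bivec R :=
  star2 M (evec (ordS a)) (evec (ordS (ordS a))).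

Definition Hbiv : bivec R := fun u w => \sum_(a < 3) Omega a * Ebiv a u w.

Variable xi : vec R.

Definition ystar : vec R := (dot M xi chi)^-1 *: contract M xi Hbiv.

Definition radicand : R :=
  dot M ystar chi ^+ 2 - dot M ystar ystar * dot M chi chi.

(* For exceptional transversal [xi], such as [x' - gamma4] with [x'] the other
   intersection of the null cone of [gamma4] with the line [x + R chi], both
   [denominator] and [dot M ystar ystar] vanish, and the expression for [kappa]
   is an undefined 0 / 0. *)
Definition denominator (ehat : R) : R :=
  dot M ystar chi + ehat * Num.sqrt radicand.

Definition kappa (ehat : R) : vec R :=
  gamma4 + ystar - (dot M ystar ystar / denominator ehat) *: chi.

End Configuration.
End Positioning.

(* Main.v *)
(* Write y = x - gamma_4, so that m_4 = y and m_a = y - e_a for a = 1, 2, 3.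
   Subtracting y^2 = 0 from m_a^2 = 0 gives y . e_a = Omega_a, and y_* solves
   the same three linear equations; hence y = y_* + lam chi for some lam. Now
   y^2 = 0 is a quadratic equation for lam whose reduced discriminant is
   (y . chi)^2, and y . chi = *(m_1 /\ m_2 /\ m_3 /\ m_4) has the sign ehat,
   so that ehat sqrt(radicand) = y . chi and lam (y_* . chi + y . chi) = - y_*^2.
   The transversal vector xi = y gives y_* = y and denominator 2 (y . chi) != 0.

   The emission coordinates of x are unique: if one world-line gave two future
   null vectors m, m' ending at x, then the mean value theorem for m . gamma and
   for m' . gamma would give m . m' both signs. *)
From HB Require Import structures.
Require Import Defs.
From mathcomp Require Import all_boot all_order all_algebra.
From mathcomp Require Import all_classical all_reals all_analysis.
From mathcomp Require Import ring lra.
Set Implicit Arguments.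
Unset Strict Implicit.
Unset Printing Implicit Defensive.
Import Order.TTheory GRing.Theory Num.Theory.
Local Open Scope ring_scope.


(** * Explicit expansion of determinants *)

(** Entries are indexed by [nat], so that a determinant of concrete size computes to an explicit
    polynomial; [bump j] skips the deleted column. *)
Fixpoint laplace {R : comNzRingType} n (F : nat -> nat -> R) : R :=
  if n is m.+1 then
    \sum_(j < n)
      F 0%N j * ((-1) ^+ j * laplace m (fun i k => F i.+1 (bump j k)))
  else 1.

Lemma det_laplace (R : comNzRingType) n (F : nat -> nat -> R) :
  \det (\matrix_(i < n, j < n) F i j) = laplace n F.
Proof.
elim: n F => [|n IHn] F; first exact: det_mx00.
rewrite (expand_det_row _ ord0); apply: eq_bigr => j _.
rewrite mxE /cofactor add0n; congr (_ * (_ * _)).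
rewrite -[RHS]IHn; congr (\det _).
by apply/matrixP => i k; rewrite !mxE.
Qed.

(** * Bilinear algebra of the inner product and the volume form *)

Section Algebra.
Context {R : realType} (M : minkowski_space R).
Implicit Types (u v w y z : vec R).

Lemma epsM_sqr : eps M * eps M = 1.
Proof. by case: (epsP M) => ->; rewrite ?mulrNN mulr1. Qed.

Lemma dotC u v : dot M u v = dot M v u.
Proof.
rewrite /dot /lorentz; congr (_ * _).
by apply: eq_bigr => i _; rewrite [u _ _ * _]mulrC.
Qed.

Lemma dot_is_scalar u : scalar (dot M u).
Proof.
move=> a v w; rewrite /dot /lorentz mulrCA -mulrDr; congr (_ * _).
by rewrite mulr_sumr -big_split; apply: eq_bigr => i _; rewrite !mxE /=; ring.
Qed.

HB.instance Definition _ u :=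
  GRing.isLinear.Build R (vec R) R _ (dot M u) (dot_is_scalar u).

Lemma dotDr u v w : dot M u (v + w) = dot M u v + dot M u w.
Proof. exact: linearD. Qed.

Lemma dotBr u v w : dot M u (v - w) = dot M u v - dot M u w.
Proof. exact: linearB. Qed.

Lemma dotZr a u v : dot M u (a *: v) = a * dot M u v.
Proof. exact: linearZ. Qed.

Lemma dotDl u v w : dot M (u + v) w = dot M u w + dot M v w.
Proof. by rewrite !(dotC _ w) dotDr. Qed.

Lemma dotBl u v w : dot M (u - v) w = dot M u w - dot M v w.
Proof. by rewrite !(dotC _ w) dotBr. Qed.

Lemma dotZl a u v : dot M (a *: u) v = a * dot M u v.
Proof. by rewrite !(dotC _ v) dotZr. Qed.


Lemma eps_dotE u v :
  let x k := u 0 (inord k) in let y k := v 0 (inord k) in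
  eps M * dot M u v =
  - (x 0%N * y 0%N) + (x 1%N * y 1%N + x 2%N * y 2%N + x 3%N * y 3%N).
Proof.
have E (w : vec R) i : w 0 i = w 0 (inord i) by rewrite inord_val.
rewrite /= /dot /lorentz mulrA epsM_sqr mul1r.
under eq_bigr do rewrite (E u) (E v).
by rewrite !big_ord_recl big_ord0 /msign /= /bump /= mulN1r !mul1r addr0 !addrA.
Qed.

Let vol_monomial v0 v1 v2 v3 (p q r s : nat) : R :=
  v0 0 (inord p) * v1 0 (inord q) * v2 0 (inord r) * v3 0 (inord s).

(** The Leibniz expansion, one monomial per permutation, makes the next four identities polynomial
    ones, within reach of [ring]. *)
Lemma volE v0 v1 v2 v3 : vol M v0 v1 v2 v3 = ori M * (
  let m := vol_monomial v0 v1 v2 v3 in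
    m 0 1 2 3 - m 0 1 3 2 - m 0 2 1 3 + m 0 2 3 1 + m 0 3 1 2 - m 0 3 2 1
  - m 1 0 2 3 + m 1 0 3 2 + m 1 2 0 3 - m 1 2 3 0 - m 1 3 0 2 + m 1 3 2 0
  + m 2 0 1 3 - m 2 0 3 1 - m 2 1 0 3 + m 2 1 3 0 + m 2 3 0 1 - m 2 3 1 0
  - m 3 0 1 2 + m 3 0 2 1 + m 3 1 0 2 - m 3 1 2 0 - m 3 2 0 1 + m 3 2 1 0).
Proof.
rewrite /vol /=; congr (_ * _).
have -> : (\matrix_(i < 4) nth 0 [:: v0; v1; v2; v3] i) =
  \matrix_(i, j) nth 0 [:: v0; v1; v2; v3] i 0 (inord j).
  by apply/matrixP => i j; rewrite !mxE inord_val.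
pose F i j : R := nth 0 [:: v0; v1; v2; v3] i 0 (inord j).
rewrite (@det_laplace R 4 F) /=.
rewrite !big_ord_recl !big_ord0 /= /bump /= /F /= /vol_monomial.
ring.
Qed.

Lemma volC v0 v1 v2 v3 : vol M v0 v1 v2 v3 = vol M v0 v2 v3 v1.
Proof. by rewrite !volE /= /vol_monomial; ring. Qed.

Lemma vol_alt01 v0 v2 v3 : vol M v0 v0 v2 v3 = 0.
Proof. by rewrite volE /= /vol_monomial; ring. Qed.

Lemma vol_alt12 v0 v1 v3 : vol M v0 v1 v1 v3 = 0.
Proof. by rewrite volE /= /vol_monomial; ring. Qed.

(** By alternation the copies of y in the first three places drop out. The sign (-1)^3 of the
    remaining factors -v_i cancels the sign of moving y past three vectors. *)
Lemma vol_subl y v1 v2 v3 :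
  vol M (y - v1) (y - v2) (y - v3) y = vol M y v1 v2 v3.
Proof. by rewrite !volE /= /vol_monomial !mxE; ring. Qed.

(** A nonzero volume makes the four vectors a basis, and the metric has no kernel. *)
Lemma dot_nondegenerate v0 v1 v2 v3 z : vol M v0 v1 v2 v3 != 0 ->
  dot M z v0 = 0 -> dot M z v1 = 0 -> dot M z v2 = 0 -> dot M z v3 = 0 -> z = 0.
Proof.
rewrite /vol; set A := \matrix_i _ => vol_neq0 z0 z1 z2 z3.
have A_unit : A \in unitmx.
  by rewrite unitmxE unitfE; apply: contraNneq vol_neq0 => ->; rewrite mulr0.
(* Up to the factor [eps M], [c] is the covector of z. *)
pose c : 'cV[R]_4 := \col_i (msign R i * z 0 i).
have dotzE v : (v *m c) 0 0 = eps M * dot M z v.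
  rewrite /dot /lorentz mulrA epsM_sqr mul1r mxE.
  by apply: eq_bigr => i _; rewrite mxE; ring.
have Ac0 : A *m c = 0.
  apply/row_matrixP => i; rewrite row_mul row0; apply/rowP => j.
  rewrite ord1 dotzE [RHS]mxE rowK.
  by case: i => -[|[|[|[|k]]]] //= _; rewrite ?z0 ?z1 ?z2 ?z3 mulr0.
apply/rowP => i; rewrite mxE.
have /colP/(_ i) : c = 0 by rewrite -(mulKmx A_unit c) Ac0 mulmx0.
rewrite !mxE /msign; case: ifP => _; rewrite ?mulN1r ?mul1r //.
by move/eqP; rewrite oppr_eq0 => /eqP.
Qed.
End Algebra.


(** * Signs of inner products of causal vectors *)

Section Causality.
Context {R : realType} (M : minkowski_space R).
Implicit Types (u v w m : vec R).

(** Lagrange's identity: the difference is a sum of three squares. *)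
Lemma cauchy_schwarz3 (a b c a' b' c' : R) :
  (a * a' + b * b' + c * c') ^+ 2 <=
  (a * a + b * b + c * c) * (a' * a' + b' * b' + c' * c').
Proof.
rewrite -subr_ge0.
suff -> : (a * a + b * b + c * c) * (a' * a' + b' * b' + c' * c') -
  (a * a' + b * b' + c * c') ^+ 2 = (a * b' - b * a') ^+ 2 +
  (b * c' - c * b') ^+ 2 + (c * a' - a * c') ^+ 2 by rewrite !addr_ge0 ?sqr_ge0.
ring.
Qed.

(** The spatial product s satisfies s^2 <= (u0 w0)^2 by Cauchy-Schwarz, strictly when w0 is nonzero,
    so the time components decide the sign of - u0 w0 + s. *)
Lemma eps_dot_lt0 u w : timelike M u -> eps M * dot M w w <= 0 ->
  (eps M * dot M u w < 0) = (0 < u 0 (inord 0) * w 0 (inord 0)).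
Proof.
rewrite /timelike !eps_dotE /=.
set u0 := u 0 (inord 0); set w0 := w 0 (inord 0).
move: (u 0 (inord 1)) (u 0 (inord 2)) (u 0 (inord 3)) => u1 u2 u3.
move: (w 0 (inord 1)) (w 0 (inord 2)) (w 0 (inord 3)) => w1 w2 w3 hu hw.
have := cauchy_schwarz3 u1 u2 u3 w1 w2 w3.
set s := u1 * w1 + _ + _; set p := u1 * u1 + _ + _ in hu *.
set q := w1 * w1 + _ + _ in hw * => cs.
have p0 : 0 <= p by rewrite /p -!expr2 !addr_ge0 ?sqr_ge0.
have q0 : 0 <= q by rewrite /q -!expr2 !addr_ge0 ?sqr_ge0.
have pqle : p * q <= u0 * u0 * (w0 * w0) by apply: ler_pM => //; lra.
have s2le : s ^+ 2 <= (u0 * w0) ^+ 2.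
  by rewrite (le_trans cs) ?(le_trans pqle)// expr2 mulrACA.
apply/idP/idP => [slt | uw0].
  rewrite ltNge; apply/negP => uw0.
  have : (u0 * w0) ^+ 2 < s ^+ 2 by nra.
  by rewrite ltNge s2le.
have w0_gt0 : 0 < w0 * w0.
  rewrite -expr2 exprn_even_gt0 //=.
  by apply: contraTneq uw0 => ->; rewrite mulr0 ltxx.
have : s ^+ 2 < (u0 * w0) ^+ 2.
  rewrite (le_lt_trans cs)// expr2 mulrACA.
  apply: (@le_lt_trans _ _ (p * (w0 * w0))).
    by apply: ler_wpM2l => //; lra.
  by rewrite ltr_pM2r //; lra.
by nra.
Qed.

(** The time components of v and m both have the sign of that of [fut M], hence the same sign. *)
Lemma future_dot_lt0 v m : timelike M v -> future M v ->
  dot M m m = 0 -> future M m -> eps M * dot M m v < 0.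
Proof.
move=> tv fv m0 fm.
have cm : eps M * dot M m m <= 0 by rewrite m0 mulr0.
have cv : eps M * dot M v v <= 0 by exact: ltW.
have tfut : timelike M (fut M) by exact: futP.
move: fm fv; rewrite /future (eps_dot_lt0 tfut cm).
rewrite (eps_dot_lt0 tfut cv) => fm fv.
rewrite dotC eps_dot_lt0 //.
move: fm fv; nra.
Qed.

End Causality.

(** * Uniqueness of the emission coordinates *)

Section Uniqueness.
Context {R : realType} {M : minkowski_space R} (P : positioning_system M).

Lemma is_derive_dot m (f : R -> vec R) t : derivable f t 1 ->
  is_derive t 1 (fun s => dot M m (f s)) (dot M m (derive1 f t)).
Proof.
move=> df.
have dfi i : is_derive t 1 (fun s => f s 0 i) (derive1 f t 0 i).
  have /derivable_mxP/(_ 0 i) dfi := df.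
  by apply: DeriveDef => //; rewrite derive1E derive_mx // mxE.
pose g i := (eps M * (msign R i * m 0 i)) \*: (fun s => f s 0 i).
have -> : (fun s => dot M m (f s)) = \sum_(i < 4) g i.
  apply/funext => s; rewrite fct_sumE /dot /lorentz mulr_sumr.
  by apply: eq_bigr => i _; rewrite /g /= !mulrA.
have -> : dot M m (derive1 f t) =
    \sum_(i < 4) (eps M * (msign R i * m 0 i)) *: derive1 f t 0 i.
  rewrite /dot /lorentz mulr_sumr.
  by apply: eq_bigr => i _; rewrite /= !mulrA.
exact: is_derive_sum.
Qed.

(** By the mean value theorem the increment of m . gamma is t - s times m . gamma' at an
    intermediate time, where gamma' is future time-like. *)
Lemma wl_increment A (s t : R) m : dom P A s -> dom P A t -> s < t ->
  dot M m m = 0 -> future M m ->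
  eps M * dot M m (wl P A t - wl P A s) < 0.
Proof.
move=> ds dt st m0 fm.
have dom_st r : s <= r <= t -> dom P A r by exact: dom_itv.
have dP r : s <= r <= t -> is_derive r 1 (fun r => dot M m (wl P A r))
    (dot M m (derive1 (wl P A) r)).
  move=> /dom_st dr; apply: is_derive_dot.
  exact: (@wl_smooth _ _ P A 0%N r dr).
have [||c ic] := @MVT R (fun r => dot M m (wl P A r))
  (fun r => dot M m (derive1 (wl P A) r)) s t st.
- by move=> r; rewrite in_itv /= => /andP[sr rt]; apply: dP; rewrite !ltW.
- apply: derivable_within_continuous => r; rewrite in_itv /= => /dP dr.
  exact: ex_derive.
rewrite dotBr => ->; rewrite mulrA pmulr_llt0 ?subr_gt0 //.
have dc : dom P A c.
  by apply: dom_st; move: ic; rewrite in_itv /= => /andP[? ?]; rewrite !ltW.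
by apply: future_dot_lt0 => //; [exact: wl_timelike | exact: wl_future].
Qed.

Lemma emission_coordinates_unique x (tau tau' : 'I_4 -> R) :
  emission_coordinates P x tau -> emission_coordinates P x tau' -> tau = tau'.
Proof.
have no_lt (s t : 'I_4 -> R) A : emission_coordinates P x s ->
    emission_coordinates P x t -> ~~ (s A < t A).
  move=> /(_ A)[ds s0 fs] /(_ A)[dt t0 ft]; apply/negP => st.
  have := wl_increment ds dt st s0 fs.
  have := wl_increment ds dt st t0 ft.
  (* The increment is u - v with u, v the null vectors at times s, t; pairing it with u gives - u .
     v, and with v gives u . v. *)
  have -> : wl P A (t A) - wl P A (s A) = mvec P x s A - mvec P x t A.
    by rewrite /mvec opprB [RHS]addrC addrA subrK.
  move: (mvec P x s A) (mvec P x t A) s0 t0 => u v s0 t0.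
  rewrite !dotBr s0 t0 subr0 sub0r mulrN oppr_lt0 dotC => lt gt.
  by have := lt_trans lt gt; rewrite ltxx.
move=> ex ex'; apply/funext => A; apply/eqP.
by rewrite eq_le !leNgt !no_lt.
Qed.

End Uniqueness.


(** * Null points on a line: the quadratic equation for the parameter *)

Section NullLine.
Context {R : realType} {M : minkowski_space R} (p c : vec R) (lam : R).
Hypothesis y_null : dot M (p + lam *: c) (p + lam *: c) = 0.

Lemma null_line_radicand :
  dot M p c ^+ 2 - dot M p p * dot M c c = dot M c (p + lam *: c) ^+ 2.
Proof.
move: y_null; rewrite !dotDl !dotDr !dotZl !dotZr [dot M c p]dotC.
move: (dot M p p) (dot M p c) (dot M c c) => pp pc cc h.
rewrite -[LHS]subr0 -[X in _ - X](mulr0 (- cc)) -h; ring.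
Qed.

(** Factoring lam out of p^2 + 2 lam (p . c) + lam^2 c^2 = 0 avoids dividing by c^2, which vanishes
    for null configurations. *)
Lemma null_line_parameter :
  lam * (dot M p c + dot M c (p + lam *: c)) = - dot M p p.
Proof.
move: y_null; rewrite !dotDl !dotDr !dotZl !dotZr [dot M c p]dotC => h.
by apply/eqP; rewrite -subr_eq0 opprK -h; apply/eqP; ring.
Qed.
End NullLine.

(** * The emitter configuration and its linear equations *)

Section Configuration.
Context {R : realType} {M : minkowski_space R} (P : positioning_system M).
Context (tau : 'I_4 -> R).
Local Notation e a := (evec P tau (inord a)).

Lemma star4_mvec x :
  star4 M (mvec P x tau) = dot M (chi P tau) (x - gamma4 P tau).
Proof.
rewrite dot_star3 -vol_subl /star4.
have -> : mvec P x tau (inord 3) = x - gamma4 P tau.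
  by rewrite /mvec /gamma4 (_ : inord 3 = ord_max) //;
     apply/val_inj; rewrite /= inordK.
have mE a : (a < 3)%N ->
    mvec P x tau (inord a) = x - gamma4 P tau - e a.
  move=> a3; rewrite /evec opprB addrA subrK /mvec; congr (_ - wl P _ (tau _));
  by apply/val_inj; rewrite /= !inordK // (ltn_trans a3).
by rewrite !mE.
Qed.

Lemma dot_evec x a : emission_coordinates P x tau ->
  dot M (x - gamma4 P tau) (evec P tau a) = Omega P tau a.
Proof.
set y := x - _ => ex.
have [_ y0 _] := ex ord_max; have [_] := ex (widen_ord (leqnSn 3) a).
have -> : mvec P x tau (widen_ord (leqnSn 3) a) = y - evec P tau a.
  by rewrite /evec opprB addrA subrK.
rewrite -[mvec _ _ _ _]/y in y0.
rewrite /Omega; move: y y0 (evec P tau a) => y y0 ea.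
rewrite !dotBr !dotBl y0 [dot M ea y]dotC => m0 _; lra.
Qed.

Lemma dot_chi_evec a : dot M (chi P tau) (evec P tau a) = 0.
Proof.
rewrite dot_star3 -[a]inord_val.
case: a => -[|[|[|k]]] //= _; first by rewrite vol_alt01.
- by rewrite volC vol_alt01.
- by rewrite 2!volC vol_alt01.
Qed.

(** The value is eta(xi, e_a, e_{b+1}, e_{b+2}): a vector repeats unless a = b, and then the e's are
    a cyclic, hence even, permutation of those in [chi]. *)
Lemma Ebiv_evec a b xi :
  Ebiv P tau b xi (evec P tau a) = (a == b)%:R * dot M xi (chi P tau).
Proof.
have ordSE k : (k < 3)%N -> ordS (inord k) = inord (k.+1 %% 3) :> 'I_3.
  by move=> k3; apply/val_inj; rewrite /= !inordK ?ltn_pmod.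
rewrite dotC dot_star3 /Ebiv /star2.
rewrite -[in LHS](inord_val a) -[in LHS](inord_val b).
case: a => -[|[|[|i]]] //= ?; case: b => -[|[|[|j]]] //= ?;
  rewrite !ordSE //= ?mul1r ?mul0r ?vol_alt12 //.
all: try by rewrite volC ?vol_alt12.
all: by rewrite volC [LHS]volC ?vol_alt12.
Qed.

Lemma dot_contract_Hbiv xi w :
  dot M (Defs.contract M xi (Hbiv P tau)) w = Hbiv P tau xi w.
Proof.
have H_scalar : scalar (Hbiv P tau xi).
  move=> c u v; rewrite /Hbiv mulr_sumr -big_split; apply: eq_bigr => a _ /=.
  by rewrite /Ebiv /star2 vol_linear2; ring.
pose F : {scalar vec R} := HB.pack (Hbiv P tau xi)
  (GRing.isLinear.Build _ _ _ _ _ H_scalar).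
exact: (dot_sharp M F w).
Qed.

(** * The particular solution [ystar] and the formula for x *)

Section Transversal.
Context (xi : vec R) (xi_transversal : dot M xi (chi P tau) != 0).

Lemma dot_ystar_evec a : dot M (ystar P tau xi) (evec P tau a) = Omega P tau a.
Proof.
rewrite dotZl dot_contract_Hbiv /Hbiv (bigD1 a) //= Ebiv_evec eqxx mul1r.
rewrite big1 ?addr0 => [|b ba]; first by rewrite mulrC mulfK.
by rewrite Ebiv_evec eq_sym (negPf ba) mul0r mulr0.
Qed.

(** H is alternating, so H(xi, xi) = 0. This identifies [ystar] when xi = y. *)
Lemma dot_ystar_transversal : dot M (ystar P tau xi) xi = 0.
Proof.
rewrite dotZl dot_contract_Hbiv /Hbiv big1 ?mulr0 // => b _.
by rewrite /Ebiv /star2 vol_alt01 mulr0.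
Qed.

Context (x : vec R) (x_tau : emission_coordinates P x tau).
Context (x_regular : star4 M (mvec P x tau) != 0).
Let y := x - gamma4 P tau.

(** Both y - [ystar] and [chi] are orthogonal to every e_a, and y, e_1, e_2, e_3 form a basis
    because their volume is chi . y, which is nonzero. *)
Lemma position_on_chi_line :
  exists lam, y = ystar P tau xi + lam *: chi P tau.
Proof.
have chiy0 : dot M (chi P tau) y != 0 by rewrite -star4_mvec.
have [d dE] : exists d, d = y - ystar P tau xi by exists (y - ystar P tau xi).
have de a : dot M d (evec P tau a) = 0.
  by rewrite dE dotBl dot_ystar_evec dot_evec // subrr.
(* This parameter makes d - lam chi orthogonal to y as well. *)
exists (dot M d y / dot M (chi P tau) y).
apply/eqP; rewrite -subr_eq0 opprD addrA -dE; apply/eqP.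
apply: (@dot_nondegenerate _ M y (e 0) (e 1) (e 2)).
- by rewrite -dot_star3.
- by rewrite dotBl [dot M (_ *: _) _]dotZl divfK // subrr.
all: by rewrite dotBl [dot M (_ *: _) _]dotZl dot_chi_evec de mulr0 subrr.
Qed.

Lemma dot_position : dot M y y = 0.
Proof. by have [_ ? _] := x_tau ord_max. Qed.

Lemma radicandE : radicand P tau xi = dot M (chi P tau) y ^+ 2.
Proof.
have [lam yE] := position_on_chi_line; have := dot_position.
by rewrite yE => /null_line_radicand.
Qed.

Lemma denominatorE : denominator P tau xi (orientation P x tau) =
  dot M (ystar P tau xi) (chi P tau) + dot M (chi P tau) y.
Proof.
rewrite /denominator radicandE sqrtr_sqr.
by rewrite /orientation star4_mvec mulr_sg_norm.
Qed.

Lemma position_kappa : denominator P tau xi (orientation P x tau) != 0 ->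
  x = kappa P tau xi (orientation P x tau).
Proof.
rewrite /kappa denominatorE.
have [lam yE] := position_on_chi_line; have := dot_position.
rewrite yE => /null_line_parameter lamE den0.
have -> : dot M (ystar P tau xi) (ystar P tau xi) =
    - (lam * (dot M (ystar P tau xi) (chi P tau) +
              dot M (chi P tau) (ystar P tau xi + lam *: chi P tau))).
  by rewrite lamE opprK.
by rewrite mulNr mulfK // scaleNr opprK -addrA -yE /y addrC subrK.
Qed.
End Transversal.

End Configuration.

Theorem theorem2 (R : realType) (M : minkowski_space R) (P : positioning_system M)
    (x : vec R) (tau : 'I_4 -> R)
    (hx : emission_coordinate_region P x)
    (htau : emission_coordinates P x tau) :
  let ehat := orientation P x tau in
  (exists2 xi, dot M xi (chi P tau) != 0 & denominator P tau xi ehat != 0) /\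
  forall xi : vec R, dot M xi (chi P tau) != 0 ->
    0 <= radicand P tau xi /\
    (denominator P tau xi ehat != 0 -> x = kappa P tau xi ehat).
Proof.
have [tau' htau' reg] := hx.
(* Membership in the region gives regularity for some coordinates of x; uniqueness transfers it to
   [tau]. *)
rewrite (emission_coordinates_unique htau' htau) in reg => {tau' htau'}.
split=> [|xi xi_chi]; last first.
  by split; [rewrite (radicandE xi_chi htau) // sqr_ge0 | exact: position_kappa].
set y := x - gamma4 P tau.
have chiy : dot M (chi P tau) y != 0 by rewrite -star4_mvec.
have y_chi : dot M y (chi P tau) != 0 by rewrite dotC.
exists y => //; rewrite denominatorE //.
have [lam] := position_on_chi_line y_chi htau reg; rewrite -/y => yE.
have lam0 : lam = 0.
  (* Pairing y = [ystar] + lam chi with y, where y^2 = 0 and [ystar] . y = 0, leaves lam (chi . y) =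
     0. *)
  have := dot_position htau; rewrite -/y {1}yE dotDl dotZl.
  rewrite dot_ystar_transversal // add0r => /eqP.
  by rewrite mulf_eq0 (negPf chiy) orbF => /eqP.
have -> : ystar P tau y = y by rewrite [RHS]yE lam0 scale0r addr0.
by rewrite -/y [dot M y _]dotC -mulr2n mulrn_eq0.
Qed.
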